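(* Let $q$ be a power of an odd prime and let $d \geq 3$ be an integer. Then every matrix in $Mat_d(\mathbb{F}_q)$ can be written as a sum of $9\cdot 6^{d-2}$ orthogonal matrices if $q \equiv 3 \pmod 4$, and as a sum of $8 \cdot 6^{d-2}$ orthogonal matrices if $q \equiv 1 \pmod 4$.
   Context: $Mat_d(\mathbb{F}_q)$ denotes the $d\times d$ matrices over the finite field $\mathbb{F}_q$, and the orthogonal matrices are the elements of $O(d;q) = \{A \in Mat_d(\mathbb{F}_q) : A^TA = I\}$. ''A sum of $m$ orthogonal matrices'' means $A = B_1+\dots+B_m$ with each $B_j\in O(d;q)$, repetitions allowed. *)

(* Defs.v *)
From mathcomp Require Import all_boot all_order all_algebra.

Set Implicit Arguments.
Unset Strict Implicit.
Unset Printing Implicit Defensive.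

Import GRing.Theory.
Local Open Scope ring_scope.

Definition orthogonal_mx (F : fieldType) (d : nat) (A : 'M[F]_d) : Prop :=
  A^T *m A = 1%:M.

(* Exactly m summands, repetitions allowed. *)
Definition sum_of_orthogonal (F : fieldType) (d m : nat) (A : 'M[F]_d) : Prop :=
  exists B : 'I_m -> 'M[F]_d,
    (forall j, orthogonal_mx (B j)) /\ A = \sum_(j < m) B j.

(* Main.v *)
Require Import Defs.
From mathcomp Require Import all_boot all_order all_algebra.
From mathcomp Require Import perm finfield ring zify.

(** Let [c *: delta_mx i j] be a multiple of a matrix unit, and let
    [H_i = 1 - 2 *: delta_mx i i] be the reflection negating the [i]-th
    coordinate.  For every orthogonal [R],
<<
      R - H_i R - R H_j + H_i R H_j = (1 - H_i) R (1 - H_j)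
                                    = 4 R_ij *: delta_mx i j,
>>
    and the four terms on the left are orthogonal.  Hence each multiple of a
    matrix unit is a sum of four orthogonal matrices as soon as an orthogonal
    matrix can have any prescribed scalar [a] (here [c / 4]) in position
    [(i, j)] ([orthogonal_mx_prescribed_entry]).  Such a matrix exists in
    dimension at least 3: in a finite field of odd order every element is a sum
    of two squares ([sum_two_squares]), so [1 - a ^+ 2 = x ^+ 2 + y ^+ 2], and
    for [a != 1] the reflection exchanging the unit vectors [e_i] and
    [a e_i + x e_k + y e_l] has diagonal entry [a] at [i]; permuting columns
    moves this entry to any column.

    Splitting a matrix into its [d ^ 2] entries writes it as a sum of [4 d ^ 2]
    orthogonal matrices.  Cancelling pairs [1 + (- 1)] raise the number of
    summands by any even amount, and [8 * 6 ^ (d - 2)] and [9 * 6 ^ (d - 2)]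
    are even and at least [4 d ^ 2] when [d >= 3].  The same decomposition
    serves both residues of [q] modulo 4. *)

Set Implicit Arguments.
Unset Strict Implicit.
Unset Printing Implicit Defensive.

Import GRing.Theory.

Section OrthogonalSums.

Local Open Scope ring_scope.

(** Pigeonhole: squaring is at most two-to-one, so the squares make up more
    than half of the field, and the sets of all [x ^+ 2] and of all
    [t - y ^+ 2] must meet. *)
Lemma sum_two_squares (F : finFieldType) (t : F) :
  odd #|F| -> exists x y : F, x ^+ 2 + y ^+ 2 = t.
Proof.
move=> oddF; pose S := [set x ^+ 2 | x : F].
have leF : (#|F| <= #|S| * 2)%N.
  rewrite -sum_nat_const -sum1_card (partition_big (fun x : F => x ^+ 2) (mem S)) /=; last first.
    by move=> x _; apply: imset_f.
  apply: leq_sum => _ /imsetP[z _ ->].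
  rewrite sum1dep_card; apply: (@leq_trans #|[set z; - z]|).
    by apply/subset_leq_card/subsetP => x; rewrite !inE eqf_sqr.
  by rewrite cards2; case: (_ != _).
pose T : {set F} := [set t - s | s in S].
have cardT : #|T| = #|S| by apply: card_imset => u v /addrI /oppr_inj.
have /set0Pn[s] : S :&: T != set0.
  apply/eqP => ST0; have leF2 : (#|S| + #|S| <= #|F|)%N.
    by rewrite -{2}cardT -[leqLHS]subn0 -(cards0 F) -ST0 -cardsU max_card.
  by lia.
rewrite inE => /andP[/imsetP[x _ ->] /imsetP[_ /imsetP[y _ ->] xE]].
by exists x, y; rewrite xE subrK.
Qed.

Section Field.

Variables (F : fieldType) (d : nat).
Implicit Types (A B : 'M[F]_d) (m n : nat).

Lemma orthogonal_mx1 : orthogonal_mx (1%:M : 'M[F]_d).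
Proof. by rewrite /orthogonal_mx trmx1 mul1mx. Qed.

Lemma orthogonal_mxN A : orthogonal_mx A -> orthogonal_mx (- A).
Proof. by rewrite /orthogonal_mx [(- A)^T]linearN /= mulNmx mulmxN opprK. Qed.

Lemma orthogonal_mxM A B :
  orthogonal_mx A -> orthogonal_mx B -> orthogonal_mx (A *m B).
Proof.
by rewrite /orthogonal_mx trmx_mul => oA oB; rewrite mulmxA -(mulmxA B^T) oA mulmx1.
Qed.

Lemma orthogonal_perm_mx (s : 'S_d) : orthogonal_mx (perm_mx s : 'M[F]_d).
Proof. by rewrite /orthogonal_mx tr_perm_mx -perm_mxM mulVg perm_mx1. Qed.

Definition reflection_mx (w : 'cV[F]_d) : 'M[F]_d :=
  1%:M - (2 / (w^T *m w) 0 0) *: (w *m w^T).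

Lemma orthogonal_reflection_mx (w : 'cV[F]_d) :
  (w^T *m w) 0 0 != 0 -> orthogonal_mx (reflection_mx w).
Proof.
rewrite /orthogonal_mx /reflection_mx; set n := (_ *m _) 0 0 => n0.
set W := w *m w^T.
have trW : W^T = W by rewrite trmx_mul trmxK.
have WW : W *m W = n *: W.
  by rewrite /W mulmxA -(mulmxA w) [w^T *m w]mx11_scalar mul_mx_scalar -scalemxAl.
have -> : (1%:M - (2 / n) *: W)^T = 1%:M - (2 / n) *: W.
  by rewrite linearB linearZ /= trmx1 trW.
rewrite mulmxBl mul1mx mulmxBr mulmx1.
rewrite -scalemxAl -scalemxAr WW !scalerA -mulrA mulfVK //.
by apply/matrixP => i j; rewrite !mxE; ring.
Qed.

Lemma reflection_mx_delta (i : 'I_d) :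
  reflection_mx (delta_mx i 0) = 1%:M - 2 *: delta_mx i i.
Proof.
by rewrite /reflection_mx trmx_delta !mul_delta_mx mxE eqxx divr1.
Qed.

Lemma dot_delta_col (i : 'I_d) :
  ((delta_mx i 0 : 'cV[F]_d)^T *m (delta_mx i 0 : 'cV[F]_d)) 0 0 = 1.
Proof. by rewrite trmx_delta mul_delta_mx mxE. Qed.

Lemma mul_delta_mx_delta (R : 'M[F]_d) (i j : 'I_d) :
  delta_mx i i *m R *m delta_mx j j = R i j *: delta_mx i j.
Proof.
rewrite -(mul_delta_mx (0 : 'I_1) i i) -(mul_delta_mx (0 : 'I_1) j j).
rewrite -(mulmxA (delta_mx i 0)) -rowE mulmxA -(mulmxA (delta_mx i 0)) -colE.
rewrite [col j _]mx11_scalar mul_mx_scalar -scalemxAl mul_delta_mx.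
by rewrite !mxE.
Qed.

(** With [H_i] the reflection negating the [i]-th coordinate, this is the
    expansion of [(1 - H_i) R (1 - H_j)]; both outer factors are twice a
    diagonal matrix unit, so only the entry [(i, j)] of [R] survives. *)
Lemma orthogonal_sum4_delta (R : 'M[F]_d) (i j : 'I_d) :
  orthogonal_mx R -> sum_of_orthogonal 4 ((4 * R i j) *: delta_mx i j).
Proof.
move=> oR; pose H k := reflection_mx (delta_mx k 0).
have oH k : orthogonal_mx (H k).
  by apply: orthogonal_reflection_mx; rewrite dot_delta_col oner_neq0.
have deltaH k : 1%:M - H k = 2 *: delta_mx k k.
  by rewrite /H reflection_mx_delta opprB addrC subrK.
exists (fun k : 'I_4 => nth 0 [:: R; - (H i *m R); - (R *m H j); H i *m R *m H j] k).
split.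
  case=> [[|[|[|[|//]]]] _] /=; try by [].
  - exact/orthogonal_mxN/orthogonal_mxM.
  - exact/orthogonal_mxN/orthogonal_mxM.
  - exact/orthogonal_mxM/oH/orthogonal_mxM.
have -> : (4 * R i j) *: delta_mx i j = (1%:M - H i) *m R *m (1%:M - H j).
  rewrite !deltaH -!scalemxAl -!scalemxAr mul_delta_mx_delta !scalerA.
  by congr (_ *: _); ring.
move: (H i) (H j) => Hi Hj.
rewrite !big_ord_recl big_ord0 /= addr0 mulmxBr mulmx1 !mulmxBl !mul1mx.
by rewrite opprB !addrA [RHS]addrAC.
Qed.

Lemma sum_of_orthogonalD m n A B :
  sum_of_orthogonal m A -> sum_of_orthogonal n B ->
  sum_of_orthogonal (m + n) (A + B).
Proof.
move=> [f [of_ ->]] [g [og ->]].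
exists (fun k => match split k with inl i => f i | inr j => g j end); split.
  by move=> k; case: (split k).
rewrite big_split_ord; congr (_ + _); apply: eq_bigr => k _.
  by rewrite -[lshift _ _]/(unsplit (inl k)) unsplitK.
by rewrite -[rshift _ _]/(unsplit (inr k)) unsplitK.
Qed.

Lemma sum_of_orthogonal0 : @sum_of_orthogonal F d 0 0.
Proof. by exists (fun=> 0); split; [case | rewrite big_ord0]. Qed.

Lemma sum_of_orthogonal_sum (I : finType) m (f : I -> 'M[F]_d) :
  (forall i, sum_of_orthogonal m (f i)) ->
  sum_of_orthogonal (#|I| * m) (\sum_i f i).
Proof.
move=> of_; rewrite -sum_nat_const.
by apply: (big_ind2 (fun n => @sum_of_orthogonal F d n));
  [exact: sum_of_orthogonal0 | move=> *; exact: sum_of_orthogonalD |].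
Qed.

(** Each missing pair of summands is filled with [1 + (- 1) = 0]. *)
Lemma sum_of_orthogonal_pad m n A :
  (m <= n)%N -> ~~ odd (n - m) -> sum_of_orthogonal m A -> sum_of_orthogonal n A.
Proof.
move=> le_mn even_nm oA.
have -> : n = (m + #|'I_(n - m)./2| * 2)%N by rewrite card_ord; lia.
rewrite -[A]addr0 -[X in _ + X](@big1_eq _ _ +%R 'I_(n - m)./2 (index_enum _) xpredT).
apply: sum_of_orthogonalD => //; apply: sum_of_orthogonal_sum => _.
exists (fun k : 'I_2 => if k == 0 then 1%:M else - 1%:M); split.
  by move=> k; case: ifP => _; [|apply: orthogonal_mxN]; exact: orthogonal_mx1.
by rewrite !big_ord_recl big_ord0 /= addr0 subrr.
Qed.

End Field.

Section PrescribedEntry.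

Variables (F : fieldType) (d : nat).
Hypotheses (two_neq0 : 2 != 0 :> F) (d_ge3 : (3 <= d)%N).
Hypothesis two_squares : forall t : F, exists x y, x ^+ 2 + y ^+ 2 = t.

(** If [v = a e_i + x e_k + y e_l] has norm 1, then [w = v - e_i] has norm
    [2 - 2 a], and the reflection along [w] maps [e_i] to [v].  For [a = 1]
    this [w] is isotropic and the identity matrix takes its place. *)
Lemma orthogonal_mx_prescribed_diag (a : F) (i : 'I_d) :
  exists2 R : 'M[F]_d, orthogonal_mx R & R i i = a.
Proof.
have [->|a_neq1] := eqVneq a 1.
  by exists 1%:M; [exact: orthogonal_mx1 | rewrite mxE eqxx].
have [x [y xyE]] := two_squares (1 - a ^+ 2).
have /card_gt1P[k [l [ki li kl]]] : (1 < #|[set~ i]|)%N.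
  by rewrite cardsC1 card_ord; lia.
rewrite !inE in ki li.
pose w : 'cV[F]_d :=
  \col_m (if m == i then a - 1 else if m == k then x else if m == l then y else 0).
have wE : (w^T *m w) 0 0 = 2 * (1 - a).
  rewrite mxE (bigD1 i) //= (bigD1 k) //= (bigD1 l) /=; last by rewrite li eq_sym.
  rewrite big1 => [|m /andP[/andP[mi mk] ml]]; last first.
    by rewrite !mxE (negPf mi) (negPf mk) (negPf ml) mulr0.
  rewrite !mxE !eqxx (negPf ki) (negPf li) eq_sym (negPf kl) addr0 -!expr2 xyE.
  by ring.
have a1 : 1 - a != 0 by rewrite subr_eq0 eq_sym.
exists (reflection_mx w).
  by apply: orthogonal_reflection_mx; rewrite wE mulf_neq0.
rewrite /reflection_mx wE !mxE big_ord1 !mxE !eqxx /=.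
by field; rewrite a1 two_neq0.
Qed.

Lemma orthogonal_mx_prescribed_entry (a : F) (i j : 'I_d) :
  exists2 R : 'M[F]_d, orthogonal_mx R & R i j = a.
Proof.
have [R oR Rii] := orthogonal_mx_prescribed_diag a i.
exists (xcol i j R); last by rewrite mxE tpermR.
by rewrite xcolE; apply: orthogonal_mxM => //; apply: orthogonal_perm_mx.
Qed.

Lemma sum_of_orthogonal_4sqr (A : 'M[F]_d) : sum_of_orthogonal (4 * d ^ 2) A.
Proof.
have -> : (4 * d ^ 2 = #|{: 'I_d * 'I_d}| * 4)%N.
  by rewrite card_prod card_ord mulnC.
rewrite [A]matrix_sum_delta pair_bigA.
apply: sum_of_orthogonal_sum => -[i j] /=.
have four_neq0 : 4 != 0 :> F by rewrite (natrM _ 2 2) mulf_neq0.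
have [R oR Rij] := orthogonal_mx_prescribed_entry (A i j / 4) i j.
have := orthogonal_sum4_delta i j oR.
by rewrite Rij mulrC divfK.
Qed.

End PrescribedEntry.

End OrthogonalSums.

Lemma leq_4sqr_8exp6 d : 3 <= d -> 4 * d ^ 2 <= 8 * 6 ^ (d - 2).
Proof.
case: d => [|[|[|n]]] // _; rewrite !subSS subn0.
elim: n => [|n IHn] //; rewrite [6 ^ _]expnS; nia.
Qed.

Theorem theorem1p3 (p k q d : nat) (F : finFieldType)
    (p_prime : prime p) (p_odd : odd p) (k_gt0 : 0 < k) (q_eq : q = p ^ k)
    (cardF : #|F| = q) (d_ge3 : 3 <= d) :
  (q = 3 %[mod 4] ->
     forall A : 'M[F]_d, sum_of_orthogonal (9 * 6 ^ (d - 2)) A) /\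
  (q = 1 %[mod 4] ->
     forall A : 'M[F]_d, sum_of_orthogonal (8 * 6 ^ (d - 2)) A).
Proof.
have two_neq0 : (2%:R != 0 :> F)%R.
  have charF : p \in [pchar F]%R.
    by apply: (card_finPcharP (n := k)); rewrite // cardF.
  by rewrite -(dvdn_pcharf charF) dvdn_prime2 //; apply: contraTneq p_odd => ->.
have two_squares (t : F) : (exists x y : F, x ^+ 2 + y ^+ 2 = t)%R.
  by apply: sum_two_squares; rewrite cardF q_eq oddX p_odd orbT.
have bound := leq_4sqr_8exp6 d_ge3.
have even6 : ~~ odd (6 ^ (d - 2)) by rewrite oddX orbF; lia.
by split=> _ A; apply: (sum_of_orthogonal_pad _ _
  (sum_of_orthogonal_4sqr two_neq0 d_ge3 two_squares A)); lia.
Qed.
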